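(* The following bounds on burning numbers hold. (i) (Hamming graphs) For all integers $n\geq 1$ and $q\geq 2$, $$\left\lfloor\left(1-\frac1q\right)n\right\rfloor+1\;\leq\;\mathrm{burn}(H(n,q))\;\leq\;\left\lfloor\left(1-\frac1q\right)n+\frac{q+1}2\right\rfloor.$$ (ii) (Johnson graphs) For all integers $n,k$ with $1\leq k\leq n-1$ and $n\geq 2k$, $$\left\lceil\left(1-\frac kn\right)k\right\rceil+1\;\leq\;\mathrm{burn}(J(n,k))\;\leq\;\left\lfloor\left(1-\frac1{\lceil\frac nk\rceil}\right)k+\frac12\left(\left\lceil\frac nk\right\rceil+1\right)\right\rfloor.$$ (iii) (Halved cubes) For all integers $n\geq 2$, $$\mathrm{burn}\big(\tfrac12H(n,2)\big)=\left\lceil \frac{n}{4}\right\rceil+1.$$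
   Context: Burning number. Let $X$ be a connected (finite, simple) graph with vertex set $V$. The distance $\mathrm{dist}(u,v)$ between $u,v\in V$ is the number of edges in a shortest path between them. For a nonnegative integer $i$ and $u\in V$, let $\Gamma_i(u):=\{v\in V:\mathrm{dist}(u,v)\leq i\}$ (so $\Gamma_0(u)=\{u\}$). A sequence of $b$ vertices $v_1,v_2,\ldots,v_b$ satisfying $\bigcup_{1\leq i\leq b}\Gamma_{b-i}(v_i)=V$ is called a burning sequence of length $b$. The burning number $\mathrm{burn}(X)$ is the minimum $b$ such that there exists a burning sequence of length $b$. Graphs. Write $[n]:=\{1,2,\ldots,n\}$. The Hamming graph $H(n,q)$ (for integers $n\geq 1$, $q\geq 2$) has vertex set $\{(x_1,\ldots,x_n):x_i\in[q]\}$, and two vertices $x,y$ are adjacent if and only if $|\{i:x_i\neq y_i\}|=1$. The Johnson graph $J(n,k)$ (for integers $1\leq k\leq n-1$) has as vertex set $\binom{[n]}{k}$, the set of all $k$-element subsets of $[n]$, and two vertices $u,v$ are adjacent if and only if $|u\cap v|=k-1$. The halved $n$-cube $\frac12H(n,2)$ (for an integer $n\geq 2$) has vertex set $\{(x_1,\ldots,x_n):x_i\in\mathbb{F}_2,\ \sum_{i=1}^n x_i=0\}$, where $\mathbb{F}_2$ is the field with two elements, and two vertices $x,y$ are adjacent if and only if $|\{i:x_i\neq y_i\}|=2$. *)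

(* Defs.v *)
From mathcomp Require Import all_boot all_order all_algebra.

Set Implicit Arguments.
Unset Strict Implicit.
Unset Printing Implicit Defensive.

Record sgraph := SGraph {
  vertex :> finType;
  adj : rel vertex;
  adj_sym : symmetric adj;
  adj_irrefl : irreflexive adj
}.

Section Burning.

Variable X : sgraph.
Implicit Types u v : X.

Definition has_path_of_length u v (d : nat) : bool :=
  [exists p : d.-tuple X,
    [&& path (@adj X) u p, last u p == v & uniq (u :: p)]].

(* A path u :: p has size p edges, and fewer than #|X| of them since its
   vertices are distinct. [find] returns the least such length, and #|X| when
   u and v lie in different components. *)
Definition dist u v : nat := find (has_path_of_length u v) (iota 0 #|X|).

Definition Gamma (i : nat) u : {set X} := [set v | dist u v <= i].

(* Indices start from 0, so tnth s i is the vertex v_(i+1) of the sequence. *)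
Definition burning (b : nat) (s : b.-tuple X) : bool :=
  \bigcup_(i < b) Gamma (b - i.+1) (tnth s i) == [set: X].

Lemma dist_refl u : dist u u = 0.
Proof.
rewrite /dist; case E: #|X| => [|m].
  by have := max_card (pred1 u); rewrite E card1.
rewrite /= ifT //; apply/existsP; exists [tuple] => /=.
by rewrite eqxx.
Qed.

Lemma exists_burning : exists b, [exists s : b.-tuple X, burning s].
Proof.
exists #|X|; apply/existsP; exists (enum_tuple X); apply/eqP/setP => v.
rewrite inE; apply/bigcupP; exists (enum_rank v) => //.
have -> : tnth (enum_tuple X) (enum_rank v) = v.
  by rewrite (tnth_nth v) /= nth_enum_rank.
by rewrite inE dist_refl.
Qed.

Definition burn : nat := ex_minn exists_burning.

End Burning.

Section Hamming.

Variables n q : nat.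

Definition hamming_adj : rel {ffun 'I_n -> 'I_q} :=
  fun x y => #|[set i | x i != y i]| == 1.

Lemma hamming_adj_sym : symmetric hamming_adj.
Proof.
by move=> x y; rewrite /hamming_adj; under eq_finset => i do rewrite eq_sym.
Qed.

Lemma hamming_adj_irrefl : irreflexive hamming_adj.
Proof.
move=> x; rewrite /hamming_adj; have -> : [set i | x i != x i] = set0.
  by apply/setP => i; rewrite !inE eqxx.
by rewrite cards0.
Qed.

Definition hamming : sgraph := SGraph hamming_adj_sym hamming_adj_irrefl.

End Hamming.

Section Johnson.

Variables n k : nat.

(* |u :&: v| = k - 1, written so that the relation is irreflexive also for
   k = 0, where k - 1 would be truncated. *)
Definition johnson_adj : rel {A : {set 'I_n} | #|A| == k} :=
  fun u v => #|val u :&: val v|.+1 == k.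

Lemma johnson_adj_sym : symmetric johnson_adj.
Proof. by move=> u v; rewrite /johnson_adj; rewrite setIC. Qed.

Lemma johnson_adj_irrefl : irreflexive johnson_adj.
Proof.
by move=> u; rewrite /johnson_adj; rewrite setIid (eqP (valP u)); elim: k.
Qed.

Definition johnson : sgraph := SGraph johnson_adj_sym johnson_adj_irrefl.

End Johnson.

Section HalvedCube.

Variable n : nat.

Definition halved_cube_adj :
    rel {x : {ffun 'I_n -> 'F_2} | (\sum_(i < n) x i == 0)%R} :=
  fun x y => #|[set i | val x i != val y i]| == 2.

Lemma halved_cube_adj_sym : symmetric halved_cube_adj.
Proof.
by move=> x y; rewrite /halved_cube_adj; under eq_finset => i do rewrite eq_sym.
Qed.

Lemma halved_cube_adj_irrefl : irreflexive halved_cube_adj.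
Proof.
move=> x; rewrite /halved_cube_adj; have -> : [set i | val x i != val x i] = set0.
  by apply/setP => i; rewrite !inE eqxx.
by rewrite cards0.
Qed.

Definition halved_cube : sgraph :=
  SGraph halved_cube_adj_sym halved_cube_adj_irrefl.

End HalvedCube.

(* Main.v *)
Require Import Defs.
From mathcomp Require Import all_boot all_order all_algebra.
From mathcomp Require Import lra ring zify.
Set Implicit Arguments.
Unset Strict Implicit.
Unset Printing Implicit Defensive.
Import Order.TTheory GRing.Theory Num.Theory.
Local Open Scope ring_scope.

(** The upper bounds are averaging arguments.  If b is the burning number, then
    no sequence burns the graph in b - 1 steps, so for any vertices
    v_0, v_1, ... some x satisfies dist(v_i, x) + i >= b - 1 for every i;
    summing over i < p bounds p * b by the largest total distance from a vertex
    to v_0, ..., v_(p-1) plus p * (p + 1) / 2 ([burn_le_average]).  The v_i are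
    chosen so that every x agrees with them a lot in total: the q constant words
    in the Hamming graph, p intervals of size k that cover 'I_n in the Johnson
    graph, a word and its (almost) complement in the halved cube.

    For the lower bounds, given v_0, v_1, ... one needs a vertex x that is far
    from all of them, with a tolerance growing linearly: dist(v_i, x) >= b - i
    ([lt_burn]).  A vertex is a 0/1 point of a polytope (one unit vector per
    coordinate, or a k-subset), and closeness to v_i is the size of its
    intersection with a set A_i.  The uniform fractional point x meets each A_i
    in the average amount x(A_i).  Theorem [rounding] turns it into a vertex B
    with |B :&: A_i| <= x(A_i) + i for all i at once.  It is a floating-colours
    argument in the manner of Beck, Spencer and Alon: as long as the coordinates
    not yet in {0, 1} leave D degrees of freedom, the point moves along a line
    on which D - 1 of the sets keep their weight, in the direction in which one
    further set does not gain weight, until some coordinate hits 0 or 1.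
    Set i is thus protected while D > i; once D <= i, whatever happens to the
    remaining D degrees of freedom costs it at most D <= i.

    In the halved cube the weight of x is not free, so x is written as v_0
    flipped along a set B of prescribed even size 2b, which puts it at distance
    exactly b from v_0; rounding is applied to the differences between v_0 and
    the v_(i+1).  The error is doubled there, but so is the distance. *)

(** * Rounding fractional points *)

Lemma exists_kernel_vector (R : fieldType) (J E : finType) (S : {set E})
    (a : J -> E -> R) :
  (#|J| < #|S|)%N ->
  exists y : E -> R, [/\ exists e, y e != 0, forall e, e \notin S -> y e = 0
    & forall j, \sum_e a j e * y e = 0].
Proof.
move=> ltJS.
pose M : 'M[R]_(#|S|, #|J|) := \matrix_(i, j) a (enum_val j) (enum_val i).
have /rowV0Pn[v /sub_kermxP vM vn0] : kermx M != 0.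
  rewrite -mxrank_eq0 mxrank_ker subn_eq0 -ltnNge.
  exact: leq_ltn_trans (rank_leq_col M) ltJS.
exists (fun e => \sum_(i < #|S| | enum_val i == e) v 0 i); split.
- have /existsP[i vi] : [exists i, v 0 i != 0].
    apply: contraNT vn0 => /existsPn v0; apply/eqP/rowP => i.
    by rewrite mxE; apply/eqP; rewrite -[_ == _]negbK v0.
  exists (enum_val i); rewrite (big_pred1 i) // => k.
  by rewrite (inj_eq enum_val_inj).
- move=> e eS; rewrite big_pred0 // => i.
  by apply: contraNF eS => /eqP <-; exact: enum_valP.
- move=> j; have := congr1 (fun w : 'rV_ _ => w 0 (enum_rank j)) vM.
  rewrite !mxE => vMj; rewrite -[RHS]vMj.
  under eq_bigr => e _ do rewrite /= mulr_sumr.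
  rewrite [RHS](partition_big (@enum_val _ (mem S)) predT) //=.
  apply: eq_bigr => e _; apply: eq_bigr => i /eqP <-.
  by rewrite !mxE enum_rankK mulrC.
Qed.

Section Rounding.

Variables (R : realFieldType) (E C : finType) (c : E -> C).
Implicit Types (x y : E -> R) (A B : {set E}).

Definition floating x : {set E} := [set e | 0 < x e < 1].

Definition floating_in x z : {set E} := [set e in floating x | c e == z].

(** The dimension of the space of moves of the floating coordinates that keep all
    cell sums: a cell with f floating coordinates contributes f - 1. *)
Definition freedom x : nat := (\sum_z #|floating_in x z|.-1)%N.

Definition rounds x B := forall e, e \notin floating x -> x e = (e \in B)%:R.

Definition same_cell_sums x y :=
  forall z, \sum_(e | c e == z) x e = \sum_(e | c e == z) y e.

Lemma fixedP x e : 0 <= x e <= 1 -> e \notin floating x -> x e = 0 \/ x e = 1.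
Proof.
move=> /andP[x0 x1]; rewrite inE negb_and -!leNgt => /orP[] h; [left|right];
  by apply/eqP; rewrite eq_le ?x0 ?x1 h.
Qed.

(** Coordinate e reaches 0 or 1 at [time e]; the first coordinate to do so stops
    the move. *)
Lemma push_to_boundary x y :
    (forall e, 0 <= x e <= 1) ->
    (forall e, e \notin floating x -> y e = 0) -> (exists e, y e != 0) ->
  exists t : R, [/\ 0 <= t, forall e, 0 <= x e + t * y e <= 1
    & floating (fun e => x e + t * y e) \proper floating x].
Proof.
move=> x01 y0 [e0 ye0].
pose time e := if 0 < y e then (1 - x e) / y e else x e / - y e.
have time_ge0 e : y e != 0 -> 0 <= time e.
  move=> ye; have /andP[xe0 xe1] := x01 e; rewrite /time.
  case: (ltgtP 0 (y e)) ye => // ye _; apply: divr_ge0; rewrite ?subr_ge0 //.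
    exact: ltW.
  by rewrite oppr_ge0 ltW.
case: (@arg_minP _ _ _ e0 (fun e => y e != 0) time ye0) => e1 ye1 min_e1.
exists (time e1).
have sub e : 0 <= x e + time e1 * y e <= 1.
  have t0 := time_ge0 _ ye1; have /andP[xe0 xe1] := x01 e.
  have [->|ye] := eqVneq (y e) 0; first by rewrite mulr0 addr0 xe0.
  have := min_e1 e ye; rewrite {2}/time; case: (ltgtP 0 (y e)) ye => // ye _.
    rewrite ler_pdivlMr // => h; apply/andP; split; last lra.
    by apply: addr_ge0 => //; apply: mulr_ge0 => //; exact: ltW.
  rewrite ler_pdivlMr ?oppr_gt0 // => h; apply/andP; split; first by lra.
  by have := mulr_ge0_le0 t0 (ltW ye); lra.
split=> //; first exact: time_ge0.
apply/properP; split.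
  apply/subsetP => e; apply: contraLR => eF.
  by move: (eF); rewrite !inE (y0 e eF) mulr0 addr0.
exists e1; first by apply: contraNT ye1 => /y0 ->.
rewrite inE /time; case: (ltgtP 0 (y e1)) ye1 => // ye _.
  by rewrite divfK ?gt_eqF // addrC subrK ltxx andbF.
by rewrite invrN mulrN mulNr divfK ?lt_eqF // subrr ltxx.
Qed.

(** Work cell by cell.  If A contains every floating coordinate of a cell, then
    its gain in this cell is the gain of the cell sum, namely 0.  Otherwise at
    most f - 1 of the f floating coordinates lie in A, and each gains at most
    1. *)
Lemma rounding_error x A B :
    (forall e, 0 <= x e <= 1) -> rounds x B ->
    same_cell_sums (fun e => (e \in B)%:R) x ->
  #|B :&: A|%:R <= \sum_(e in A) x e + (freedom x)%:R.
Proof.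
move=> x01 xB sameB.
have -> : #|B :&: A|%:R = \sum_(e in A) (e \in B)%:R :> R.
  rewrite -sum1_card natr_sum [RHS]big_mkcond [LHS]big_mkcond /=.
  by apply: eq_bigr => e _; rewrite in_setI; case: (e \in A); case: (e \in B).
rewrite (partition_big c predT) // [X in _ <= X + _](partition_big c predT) //=.
rewrite natr_sum -big_split /=; apply: ler_sum => z _.
rewrite -lerBlDl -sumrB.
pose d e : R := (e \in B)%:R - x e.
have d_fixed e : e \notin floating x -> d e = 0.
  by move=> /xB; rewrite /d => ->; rewrite subrr.
have [/subsetP sub|/subsetPn[e1]] := boolP (floating_in x z \subset A).
  rewrite (_ : \sum_(e in A | _) _ = 0) ?ler0n //.
  have /eqP := sameB z; rewrite -subr_eq0 -sumrB => /eqP d0; rewrite -[RHS]d0.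
  rewrite [RHS](bigID (mem A)) /= [X in _ = _ + X]big1 ?addr0.
    by apply: eq_bigl => e; rewrite andbC.
  move=> e /andP[ez eA]; apply: d_fixed; apply: contra eA => eF.
  by apply: sub; rewrite inE eF.
move=> e1F e1A.
rewrite (cardsD1 e1) e1F add1n /= -sum1_card natr_sum.
rewrite [leLHS]big_mkcond [leRHS]big_mkcond; apply: ler_sum => e _ /=.
have /andP[xe0 xe1] := x01 e.
have dle1 : d e <= 1 by rewrite /d; case: (e \in B); rewrite ?mulr1n ?mulr0n; lra.
case: ifP => [/andP[eA ez]|_]; last by case: ifP.
have [eF|/d_fixed] := boolP (e \in floating x); last first.
  by rewrite /d => ->; case: ifP.
move: eF; rewrite !inE => ->; rewrite ez !andbT ifT //.
by apply: contraNneq e1A => <-.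
Qed.

(** A cell cannot have exactly one floating coordinate, since its sum is an
    integer. *)
Lemma integral_of_no_freedom x :
    (forall e, 0 <= x e <= 1) ->
    (forall z, exists k, \sum_(e | c e == z) x e = k%:R) ->
  freedom x = 0%N -> floating x = set0.
Proof.
move=> x01 xint /eqP; rewrite sum_nat_eq0 => /forallP D0.
apply/eqP; rewrite -subset0; apply/subsetP => e eF.
have fe : floating_in x (c e) = [set e].
  apply/esym/eqP; rewrite eqEcard sub1set inE eF eqxx cards1 /=.
  by have := D0 (c e); case: #|_| => [|[]].
have [k] := xint (c e); rewrite (bigD1 e) //=.
have [l ->] : exists l, \sum_(i | (c i == c e) && (i != e)) x i = l%:R.
  exists (\sum_(i | (c i == c e) && (i != e)) (x i == 1%R))%N.
  rewrite natr_sum; apply: eq_bigr => i /andP[ie ne].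
  have iF : i \notin floating x.
    by apply: contra ne => iF; rewrite -in_set1 -fe inE iF.
  by case: (fixedP (x01 i) iF) => ->; rewrite ?eqxx // eq_sym oner_eq0.
move: eF; rewrite !inE => /andP[x0 x1] xk.
have : l%:R < k%:R :> R by rewrite -xk; lra.
have : k%:R < l.+1%:R :> R by rewrite -xk -natr1; lra.
by rewrite !ltr_nat; lia.
Qed.

Lemma freedom_card x :
  (freedom x + #|[set z | floating_in x z != set0]| = #|floating x|)%N.
Proof.
rewrite -[in RHS]sum1_card (partition_big c predT) //= /freedom.
rewrite -[X in (_ + X)%N]sum1_card [X in (_ + X)%N]big_mkcond -big_split /=.
apply: eq_bigr => z _; rewrite inE -card_gt0.
rewrite [RHS](eq_bigl (mem (floating_in x z))) ?sum1_card; last first.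
  by move=> e; rewrite /= [RHS]inE.
by case: #|floating_in x z| => //= m; rewrite addn1.
Qed.

(** With F floating coordinates in m cells, freedom is F - m.  Keeping m cell sums
    and the weights of the first F - m - 1 sets leaves F - 1 linear equations in
    F unknowns, hence a line of moves. *)
Lemma rounding_step x (A : nat -> {set E}) :
    (forall e, 0 <= x e <= 1) -> (0 < freedom x)%N ->
  exists x', [/\ forall e, 0 <= x' e <= 1,
    floating x' \proper floating x /\ (forall e, e \notin floating x -> x' e = x e),
    same_cell_sums x' x
    & forall i, (i < freedom x)%N -> \sum_(e in A i) x' e <= \sum_(e in A i) x e].
Proof.
move=> x01 Dgt0.
pose J : finType :=
  ({z | z \in [set z | floating_in x z != set0]} + 'I_(freedom x).-1)%type.
pose a (j : J) e : R := match j with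
  | inl z => (c e == val z)%:R | inr i => (e \in A i)%:R end.
have cJ : (#|J| < #|floating x|)%N.
  by rewrite card_sum card_sig card_ord -freedom_card addnC -addSn prednK.
have [y0 [y0n y0F y0a]] := exists_kernel_vector a cJ.
have dot (P : pred E) y : \sum_(e | P e) y e = \sum_e (P e)%:R * y e.
  by rewrite big_mkcond; apply: eq_bigr => e _; case: ifP; rewrite ?mul1r ?mul0r.
(* The sign of the kernel vector is free: it is spent on one more set. *)
pose s : R := if \sum_(e in A (freedom x).-1) y0 e <= 0 then 1 else -1.
pose y e := s * y0 e.
have ysum (P : pred E) : \sum_(e | P e) y e = s * \sum_(e | P e) y0 e.
  by rewrite mulr_sumr.
have yF e : e \notin floating x -> y e = 0 by rewrite /y => /y0F ->; rewrite mulr0.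
have yn : exists e, y e != 0.
  case: y0n => e ye; exists e; rewrite mulf_neq0 // /s.
  by case: ifP; rewrite ?oppr_eq0 oner_eq0.
have [t [t0 t01 tF]] := push_to_boundary x01 yF yn.
exists (fun e => x e + t * y e); split=> //.
- by split=> // e /yF ->; rewrite mulr0 addr0.
- move=> z; rewrite big_split /= -mulr_sumr.
  suff -> : \sum_(e | c e == z) y e = 0 by rewrite mulr0 addr0.
  have [zF|zF] := boolP (z \in [set z | floating_in x z != set0]).
    by rewrite ysum dot (y0a (inl (Sub z zF))) mulr0.
  rewrite big1 // => e /eqP ez; apply: yF; apply: contra zF => eF.
  by rewrite inE; apply/set0Pn; exists e; rewrite inE eF ez eqxx.
- move=> i iD; rewrite big_split /= -mulr_sumr -[leRHS]addr0 lerD2l.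
  apply: mulr_ge0_le0 => //; rewrite ysum.
  have [lt_i|ge_i] := ltnP i (freedom x).-1.
    by rewrite dot (y0a (inr (Ordinal lt_i))) mulr0.
  have -> : i = (freedom x).-1 by lia.
  rewrite /s; case: (lerP (\sum_(e in _) _)) => h; first by rewrite mul1r.
  by rewrite mulN1r oppr_le0 ltW.
Qed.

(** That B agrees with x on the coordinates already fixed is what makes
    [rounding_error] available to the induction, which moves on to a point with
    fewer floating coordinates. *)
Lemma rounding_within x (A : nat -> {set E}) :
    (forall e, 0 <= x e <= 1) ->
    (forall z, exists k, \sum_(e | c e == z) x e = k%:R) ->
  exists B, [/\ rounds x B, same_cell_sums (fun e => (e \in B)%:R) x
    & forall i, #|B :&: A i|%:R <= \sum_(e in A i) x e + i%:R].
Proof.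
have [n] := ubnP #|floating x|; elim: n => // n IHn in x * => lt_n x01 xint.
have [/eqP D0|] := boolP (freedom x == 0%N); last rewrite -lt0n => Dgt0.
  have xB : rounds x [set e | x e == 1].
    move=> e eF; rewrite inE.
    by case: (fixedP (x01 e) eF) => ->; rewrite ?eqxx // eq_sym oner_eq0.
  have xB' e : (e \in [set e | x e == 1])%:R = x e.
    by rewrite -xB // (integral_of_no_freedom x01 xint D0) inE.
  have same : same_cell_sums (fun e => (e \in [set e | x e == 1])%:R) x.
    by move=> z; apply: eq_bigr => e _; rewrite xB'.
  exists [set e | x e == 1]; split=> // i.
  by apply: (le_trans (rounding_error _ x01 xB same)); rewrite D0 lerD2l ler0n.
have [x' [x'01 [ltF fixed] same dec]] := rounding_step A x01 Dgt0.
have [||B [x'B sameB leB]] := IHn x' _ x'01.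
- exact: leq_trans (proper_card ltF) lt_n.
- by move=> z; have [k xk] := xint z; exists k; rewrite same.
have xB : rounds x B.
  move=> e eF; rewrite -(fixed e eF); apply: x'B.
  by apply: contra eF; apply: (subsetP (proper_sub ltF)).
have sameB' : same_cell_sums (fun e => (e \in B)%:R) x.
  by move=> z; rewrite sameB same.
exists B; split=> // i; have [lt_i|ge_i] := ltnP i (freedom x).
  by apply: (le_trans (leB i)); rewrite lerD2r dec.
by apply: (le_trans (rounding_error _ x01 xB sameB')); rewrite lerD2l ler_nat.
Qed.

End Rounding.

(** The additive error i does not depend on the number of sets: the order of the
    sets decides which of them are protected the longest. *)
Theorem rounding (R : realFieldType) (E C : finType) (c : E -> C) (x : E -> R)
    (k : C -> nat) (A : nat -> {set E}) :
    (forall e, 0 <= x e <= 1) -> (forall z, \sum_(e | c e == z) x e = (k z)%:R) ->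
  exists B : {set E}, (forall z, #|[set e in B | c e == z]| = k z) /\
    forall i, #|B :&: A i|%:R <= \sum_(e in A i) x e + i%:R.
Proof.
move=> x01 xk; have [|B [_ sameB leB]] := @rounding_within R E C c x A x01.
  by move=> z; exists (k z).
exists B; split=> // z; apply/eqP; rewrite -(eqr_nat R) -xk -sameB.
rewrite -sum1_card natr_sum big_mkcond [eqbRHS]big_mkcond /=; apply/eqP.
by apply: eq_bigr => e _; rewrite !inE andbC; case: (c e == z); case: (e \in B).
Qed.

(** * Bounding the burning number *)

Lemma in_Gamma (X : sgraph) i (u v : X) : (v \in Gamma i u) = (dist u v <= i)%N.
Proof. by rewrite inE. Qed.

(** Only the centres with i < b matter.  With functions on nat for sequences, a
    centre sequence that burns X in m <= b steps also burns it in b steps, where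
    every ball is larger. *)
Lemma burn_leP (X : sgraph) (b : nat) (x0 : X) :
  reflect (exists v : nat -> X, forall x, exists i, (dist (v i) x + i < b)%N)
          (burn X <= b)%N.
Proof.
apply: (iffP idP) => [le_b|[v coverv]].
  move: le_b; rewrite /burn; case: ex_minnP => m /existsP[s /eqP burning_s] _ le_mb.
  exists (nth x0 s) => x; have : x \in [set: X] by rewrite inE.
  rewrite -burning_s => /bigcupP[i _]; rewrite in_Gamma (tnth_nth x0) => dist_le.
  by exists i; have := ltn_ord i; lia.
rewrite /burn; case: ex_minnP => m _; apply; apply/existsP.
exists [tuple v i | i < b]; apply/eqP/setP => x; rewrite [RHS]inE.
have [i lt_b] := coverv x; have lt_ib : (i < b)%N by lia.
apply/bigcupP; exists (Ordinal lt_ib) => //.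
by rewrite in_Gamma tnth_mktuple /=; lia.
Qed.

Lemma lt_burn (X : sgraph) (b : nat) (x0 : X) :
    (forall v : nat -> X, exists x, forall i, (b <= dist (v i) x + i)%N) ->
  (b < burn X)%N.
Proof.
move=> far; rewrite ltnNge; apply/(burn_leP b x0) => -[v coverv].
by have [x far_x] := far v; have [i] := coverv x; rewrite ltnNge far_x.
Qed.

(** Since b = burn X - 1 steps do not suffice for the centres v_0, v_1, ..., some
    x has dist(v_i, x) + i >= b for all i < b, and then trivially for all i. *)
Lemma burn_le_average (X : sgraph) (v : nat -> X) (p T : nat) :
    (forall x, \sum_(i < p) (dist (v i) x + i.+1) <= T)%N ->
  (p * burn X <= T)%N.
Proof.
move=> avg; case burnE : (burn X) => [|b]; first by rewrite muln0.
have [x far] : exists x, forall i, (b <= dist (v i) x + i)%N.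
  have [/existsP[x /forallP xP]|near] :=
    boolP [exists x, [forall i : 'I_b, b <= dist (v i) x + i]]%N.
    exists x => i; have [lt_ib|le_bi] := ltnP i b; first exact: (xP (Ordinal lt_ib)).
    exact: leq_trans le_bi (leq_addl _ _).
  suff : (burn X <= b)%N by rewrite burnE ltnn.
  apply/(burn_leP b (v 0)); exists v => x.
  have /existsPn /(_ x) /forallPn[i] := near.
  by rewrite -ltnNge => lt_b; exists i.
apply: leq_trans (avg x).
rewrite -[X in (X * _)%N]card_ord -sum_nat_const; apply: leq_sum => i _.
by rewrite addnS ltnS far.
Qed.

(** The common shape of the upper bounds for Hamming and Johnson graphs: on
    average over p centres, a vertex is within (1 - 1/p) * K. *)
Lemma burn_le_spread (X : sgraph) (v : nat -> X) (p K : nat) :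
    (0 < p)%N -> (forall x, \sum_(i < p) dist (v i) x <= p.-1 * K)%N ->
  (burn X)%:Z <= Num.floor ((1 - p%:R^-1) * K%:R + (p%:R + 1) / 2 : rat).
Proof.
move=> p_gt0 spread; rewrite floor_ge_int.
have sumS : (2 * (\sum_(i < p) i.+1) = p * p.+1)%N.
  by elim: (p) => [|r IHr]; rewrite ?big_ord0 // big_ord_recr mulnDr IHr /=; lia.
have : (p * burn X <= p.-1 * K + \sum_(i < p) i.+1)%N.
  by apply: (burn_le_average (v := v)) => x; rewrite big_split /= leq_add2r.
move/(leq_mul (leqnn 2)); rewrite mulnDr sumS -(ler_nat rat).
rewrite natrD !natrM -subn1 natrB // -natr1 => h.
have p0 : 0 < p%:R :> rat by rewrite ltr0n.
rewrite -(ler_pM2l p0) -(ler_pM2l (ltr0Sn rat 1)).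
apply: (le_trans h); rewrite le_eqVlt; apply/orP; left; apply/eqP.
by field; rewrite gt_eqF.
Qed.

(** * Graph distance from an explicit metric *)

Section DistanceFromMetric.

Variables (X : sgraph) (m : X -> X -> nat).
Hypothesis m_refl : forall u, m u u = 0%N.
Hypothesis m_adj : forall u w v, adj u w -> (m u v <= (m w v).+1)%N.
Hypothesis m_descent : forall u v, u != v -> exists2 w, adj u w & (m w v < m u v)%N.

Lemma metric_le_size u p : path (@adj X) u p -> (m u (last u p) <= size p)%N.
Proof.
elim: p u => [|w p IHp] u /=; first by rewrite m_refl.
by case/andP=> uw /IHp; have := m_adj (last w p) uw; lia.
Qed.

Lemma geodesic u v :
  exists p, [/\ path (@adj X) u p, last u p = v & (size p <= m u v)%N].
Proof.
have [n] := ubnP (m u v); elim: n u => // n IHn u lt_n.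
have [->|/m_descent[w uw lt_w]] := eqVneq u v; first by exists [::].
have [|p [pw lastp sizep]] := IHn w; first by lia.
by exists (w :: p); split=> //=; [rewrite uw | lia].
Qed.

(** A walk of length m u v exists by descent; no walk is shorter, so it has no
    repeated vertex, which is what both [has_path_of_length] and the search
    bound #|X| in [dist] ask for. *)
Lemma dist_metric u v : dist u v = m u v.
Proof.
have path_m : has_path_of_length u v (m u v).
  have [p [pu lastp sizep]] := geodesic u v.
  move: lastp; case/shortenP: pu => q uq uniq_q sub_q lastq.
  have size_q : size q = m u v.
    apply/eqP; rewrite eqn_leq; apply/andP; split; last first.
      by rewrite -lastq metric_le_size.
    apply: leq_trans sizep; apply: uniq_leq_size => //.
    by case/andP: uniq_q.
  rewrite -size_q; apply/existsP; exists (in_tuple q).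
  by apply/and3P; split=> //; exact/eqP.
have min_m d : has_path_of_length u v d -> (m u v <= d)%N.
  case/existsP=> p /and3P[up /eqP <- _].
  by rewrite -[X in (_ <= X)%N](size_tuple p) metric_le_size.
have lt_m : (m u v < #|X|)%N.
  case/existsP: path_m => p /and3P[_ _ /card_uniqP cp].
  by rewrite -[m u v](size_tuple p) -[(size _).+1]/(size (u :: p)) -cp max_card.
rewrite /dist; apply/eqP; rewrite eqn_leq; apply/andP; split.
  rewrite leqNgt; apply/negP => /(before_find 0%N).
  by rewrite nth_iota // add0n path_m.
have hasp : has (has_path_of_length u v) (iota 0 #|X|).
  by apply/hasP; exists (m u v); rewrite ?mem_iota.
have := nth_find 0%N hasp; rewrite nth_iota ?add0n => [/min_m //|].
by rewrite -[X in (_ < X)%N](size_iota 0) -has_find.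
Qed.

End DistanceFromMetric.

(** * Integer parts *)

Lemma le_divn_of_rat (a m d i : nat) : (0 < d)%N ->
  a%:R <= m%:R / d%:R + i%:R :> rat -> (a <= m %/ d + i)%N.
Proof.
move=> d0; rewrite -lerBlDr ler_pdivlMr ?ltr0n // => h.
have [le_ai|lt_ia] := leqP a i; first by rewrite (leq_trans le_ai) // leq_addl.
suff : (a - i <= m %/ d)%N by lia.
by rewrite leq_divRL // -(ler_nat rat) natrM natrB // ltnW.
Qed.

Lemma floor_div_le (m d : nat) : ((m %/ d)%:R <= m%:R / d%:R :> rat).
Proof.
case: d => [|d]; first by rewrite divn0 invr0 mulr0.
by rewrite ler_pdivlMr ?ltr0n // -natrM ler_nat leq_trunc_div.
Qed.

(** * Hamming graphs *)

Definition differences (I : finType) (T : eqType) (x y : I -> T) : {set I} :=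
  [set i | x i != y i].

Lemma differencesC (I : finType) (T : eqType) (x y : I -> T) :
  differences x y = differences y x.
Proof. by apply/setP => i; rewrite !inE eq_sym. Qed.

Lemma differences_refl (I : finType) (T : eqType) (x : I -> T) :
  differences x x = set0.
Proof. by apply/setP => i; rewrite !inE eqxx. Qed.

Lemma card_differences_triangle (I : finType) (T : eqType) (x y z : I -> T) :
  (#|differences x z| <= #|differences x y| + #|differences y z|)%N.
Proof.
apply: leq_trans (leq_card_setU _ _); apply/subset_leq_card/subsetP => i.
by rewrite !inE; case: (eqVneq (x i) (y i)) => // ->.
Qed.

Section Hamming.

Variables n q : nat.

Lemma dist_hamming (u v : hamming n q) : dist u v = #|differences u v|.
Proof.
apply: (dist_metric (m := fun u v : hamming n q => #|differences u v|)).
- by move=> {}u; rewrite differences_refl cards0.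
- move=> {}u w {}v /eqP uw; rewrite -addn1 addnC -[X in (X + _)%N]uw.
  exact: card_differences_triangle.
move=> {}u {}v uv.
have [i uvi] : exists i, u i != v i.
  apply/existsP; apply: contraNT uv => /existsPn eq_uv; apply/eqP/ffunP => i.
  by apply/eqP; rewrite -[_ == _]negbK eq_uv.
exists ([ffun k => if k == i then v i else u k] : hamming n q).
  apply/eqP; rewrite (_ : [set _ | _] = [set i]) ?cards1 //.
  apply/setP => k; rewrite !inE ffunE.
  by have [->|] := eqVneq k i; rewrite ?uvi ?eqxx.
apply/proper_card/properP; split.
  apply/subsetP => k; rewrite !inE ffunE.
  by have [->|] := eqVneq k i; rewrite ?eqxx.
by exists i; rewrite !inE // ffunE !eqxx.
Qed.

(** A word is a set of pairs (position, letter) with one pair per position, so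
    positions are the cells, and the uniform point 1/q meets the graph of any
    word in n/q. *)
Lemma burn_hamming_gt : (0 < q)%N -> (n - n %/ q < burn (hamming n q))%N.
Proof.
move=> q_gt0; apply: (lt_burn ([ffun=> Ordinal q_gt0] : hamming n q)) => v.
have q0 : q%:R != 0 :> rat by rewrite pnatr_eq0 -lt0n.
pose agree i : {set 'I_n * 'I_q} := [set e | v i e.1 == e.2].
have [e|z|B [cellB leB]] :=
  @rounding rat _ _ fst (fun _ => q%:R^-1) (fun _ => 1%N) agree.
- by rewrite invr_ge0 ler0n invf_le1 ?ltr0n // ler1n.
- rewrite (eq_bigl (fun e => (e.1 == z) && true)); last by move=> e; rewrite andbT.
  rewrite -(pair_big (pred1 z) predT (fun _ _ => q%:R^-1)) /= big_pred1_eq.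
  by rewrite sumr_const card_ord -[_ *+ q]mulr_natl divff.
have /fin_all_exists[x xB] (k : 'I_n) : exists j, (k, j) \in B.
  have /eqP/cards1P[[k' j] Bk] := cellB k; exists j.
  have : (k', j) \in [set (k', j)] by rewrite inE.
  by rewrite -Bk inE /= => /andP[kjB /eqP <-].
exists ([ffun k => x k] : hamming n q) => i; rewrite dist_hamming.
have sum_agree : \sum_(e in agree i) q%:R^-1 = n%:R / q%:R :> rat.
  rewrite (eq_bigl (fun e => true && (v i e.1 == e.2))); last first.
    by move=> e; rewrite inE.
  rewrite -(pair_big_dep predT (fun k j => v i k == j) (fun _ _ => q%:R^-1)) /=.
  under eq_bigr => k _ do rewrite (big_pred1 (v i k)) //.
  by rewrite sumr_const card_ord -[_ *+ n]mulr_natl.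
have := leB i; rewrite sum_agree => /(le_divn_of_rat q_gt0).
have : (#|~: differences (v i) [ffun k => x k]| <= #|B :&: agree i|)%N.
  rewrite -(card_imset _ (can_inj (g := fst) (f := fun k => (k, x k)) _)) //.
  apply/subset_leq_card/subsetP => _ /imsetP[k + ->].
  by rewrite !inE negbK ffunE xB.
have := cardsC (differences (v i) [ffun k => x k]); rewrite card_ord /=; lia.
Qed.

(** Each position of x agrees with exactly one of the q constant words. *)
Lemma burn_hamming_le : (0 < q)%N ->
  (burn (hamming n q))%:Z <= Num.floor ((1 - q%:R^-1) * n%:R + (q%:R + 1) / 2 : rat).
Proof.
move=> q_gt0; pose colour i : 'I_q := insubd (Ordinal q_gt0) i.
apply: (burn_le_spread (v := fun i => [ffun=> colour i] : hamming n q)) => // x.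
under eq_bigr => i _ do rewrite dist_hamming -sum1_card big_mkcond.
rewrite exchange_big /= mulnC -[X in (_ <= X * _)%N](card_ord n) -sum_nat_const.
apply: leq_sum => k _; rewrite -big_mkcond sum1_card.
rewrite -[X in (_ <= X.-1)%N](card_ord q) -(cardC1 (x k)).
apply/subset_leq_card/subsetP => i.
by rewrite -[i \in _]/(k \in differences _ _) !inE ffunE /colour valKd.
Qed.

End Hamming.

(** * Johnson graphs *)

Definition interval_set n s k : {set 'I_n} := [set i : 'I_n | s <= i < s + k]%N.

Lemma card_interval_set n s k : (s + k <= n)%N -> #|interval_set n s k| = k.
Proof.
move=> le_n.
have inj : injective (widen_ord le_n \o @rshift s k).
  by move=> i j /(congr1 val) /= /addnI /val_inj.
rewrite -[RHS]card_ord -cardsT -(card_imset _ inj); apply: eq_card => i.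
rewrite inE; apply/idP/imsetP => [/andP[le_s lt_s]|[j _ ->]] /=; last first.
  by rewrite leq_addr ltn_add2l ltn_ord.
have lt_k : (i - s < k)%N by lia.
by exists (Ordinal lt_k) => //; apply: val_inj => /=; lia.
Qed.

Section Johnson.

Variables n k : nat.

Definition block (u : johnson n k) : {set 'I_n} := val u.

Definition of_block (A : {set 'I_n}) (cardA : #|A| == k) : johnson n k :=
  Sub A cardA.

Lemma of_blockK A cA : block (@of_block A cA) = A. Proof. by []. Qed.

Lemma block_inj : injective block. Proof. exact: val_inj. Qed.

Lemma card_block (u : johnson n k) : #|block u| = k.
Proof. exact/eqP/(valP u). Qed.

Lemma dist_johnson (u v : johnson n k) : dist u v = #|block u :\: block v|.
Proof.
apply: (dist_metric (m := fun u v : johnson n k => #|block u :\: block v|)).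
- by move=> {}u; rewrite setDv cards0.
- move=> {}u w {}v /eqP uw.
  have uDw : #|block u :\: block w| = 1%N.
    apply: (@addnI #|block u :&: block w|).
    by rewrite cardsID card_block addn1 -[LHS]uw.
  rewrite -addn1 addnC -[X in (X + _)%N]uDw.
  apply: leq_trans (leq_card_setU _ _); apply/subset_leq_card/subsetP => i.
  by rewrite !inE => /andP[-> ->]; rewrite andbT orNb.
move=> {}u {}v uv.
have [a] : exists a, a \in block u :\: block v.
  apply/set0Pn; apply: contra uv; rewrite setD_eq0 => sub; apply/eqP/block_inj/eqP.
  by rewrite eqEcard sub !card_block leqnn.
have [b] : exists b, b \in block v :\: block u.
  apply/set0Pn; apply: contra uv; rewrite setD_eq0 => sub; apply/eqP/block_inj/eqP.
  by rewrite eq_sym eqEcard sub !card_block leqnn.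
rewrite !inE => /andP[bu bv] /andP[av au].
have cw : #|b |: (block u :\ a)| == k.
  rewrite cardsU1 !inE (negbTE bu) andbF /= add1n.
  by have := cardsD1 a (block u); rewrite au card_block add1n => <-.
exists (of_block cw).
  rewrite /= /johnson_adj -/(block u) -/(block _).
  rewrite (_ : _ :&: _ = block u :\ a).
    by have := cardsD1 a (block u); rewrite au card_block add1n => <-.
  apply/setP => i; rewrite !inE; have [->|_] := eqVneq i b.
    by rewrite (negbTE bu) andbF.
  by case: (i == a); case: (i \in block u).
apply/proper_card/properP; split.
  apply/subsetP => i; rewrite !inE; have [->|_ /=] := eqVneq i b; first by rewrite bv.
  by case/and3P => -> _ ->.
exists a; rewrite !inE ?av ?au // eqxx /= orbF.
by apply: contraNneq av => ->.
Qed.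

(** With a single cell, the rounded sets are the k-subsets, and the uniform point
    k/n meets every k-subset in k * k / n. *)
Lemma burn_johnson_gt : (k <= n)%N -> (0 < n)%N ->
  (k - k * k %/ n < burn (johnson n k))%N.
Proof.
move=> le_kn n_gt0.
have card0 : #|interval_set n 0 k| == k by rewrite card_interval_set.
apply: (lt_burn (of_block card0)) => v.
have n0 : 0 < n%:R :> rat by rewrite ltr0n.
have [e|z|B [cellB leB]] := @rounding rat _ _ (fun _ => tt)
  (fun _ => k%:R / n%:R) (fun _ => k) (fun i => block (v i)).
- by rewrite divr_ge0 ?ler0n //= ler_pdivrMr // mul1r ler_nat.
- rewrite (eq_bigl predT) => [|e]; last by case: z.
  by rewrite sumr_const card_ord -[_ *+ n]mulr_natr divfK ?gt_eqF.
have cB : #|B| == k.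
  by rewrite -[X in _ == X](cellB tt); apply/eqP/eq_card => e; rewrite inE andbT.
exists (of_block cB) => i; rewrite dist_johnson of_blockK.
have := leB i; rewrite sumr_const card_block -[_ *+ k]mulr_natl mulrA -natrM.
move/(le_divn_of_rat n_gt0).
by have := cardsID B (block (v i)); rewrite card_block setIC; lia.
Qed.

(** When p blocks cover 'I_n, their intersections with x have total size at least
    k, so the total distance from x is at most p * k - k. *)
Lemma burn_johnson_le p : (0 < k)%N -> (k <= n)%N -> (n <= p * k)%N ->
  (burn (johnson n k))%:Z <= Num.floor ((1 - p%:R^-1) * k%:R + (p%:R + 1) / 2 : rat).
Proof.
move=> k_gt0 le_kn le_npk.
have p_gt0 : (0 < p)%N by case: p le_npk => //; lia.
(* The last interval is shifted to the left so as to fit into 'I_n. *)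
pose s i := minn (i * k) (n - k).
have card_s i : #|interval_set n (s i) k| == k.
  by rewrite card_interval_set // /s; lia.
pose v i : johnson n k := of_block (card_s i).
apply: (burn_le_spread (v := v)) => // x.
under eq_bigr => i _ do rewrite dist_johnson of_blockK.
have total : (\sum_(i < p) #|interval_set n (s i) k :&: block x|
    + \sum_(i < p) #|interval_set n (s i) k :\: block x| = p * k)%N.
  rewrite -big_split /= -[X in (X * _)%N]card_ord -sum_nat_const.
  by apply: eq_bigr => i _; rewrite cardsID; apply/eqP/card_s.
suff : (k <= \sum_(i < p) #|interval_set n (s i) k :&: block x|)%N.
  by move=> ge_k; rewrite -subn1 mulnBl mul1n -total addnC -addnBA // leq_addr.
rewrite -[X in (X <= _)%N](card_block x) -sum1_card.
under [leqRHS]eq_bigr => i _ do rewrite setIC -sum1_card big_mkcond.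
rewrite exchange_big /= [leqLHS]big_mkcond; apply: leq_sum => e _.
case: ifP => // ex; have lt_e : (e %/ k < p)%N.
  by rewrite ltn_divLR // (leq_trans (ltn_ord e)).
rewrite (bigD1 (Ordinal lt_e)) //= !inE ex /= ifT // /s.
have := leq_trunc_div e k; have := ltn_ceil e k_gt0; have := ltn_ord e.
by rewrite mulSn; lia.
Qed.

End Johnson.

(** * Halved cubes *)

Definition flip n (x : {ffun 'I_n -> 'F_2}) (B : {set 'I_n}) : {ffun 'I_n -> 'F_2} :=
  [ffun i => x i + (i \in B)%:R].

Lemma F2_add_neq (a d : 'F_2) (b : bool) : (a + b%:R != d) = b (+) (a != d).
Proof. by case: a d b => [[|[|a]] ?] [[|[|d]] ?] []. Qed.

(** The differences of [flip x B] and y are the symmetric difference of B and the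
    differences of x and y. *)
Lemma card_differences_flip n (x y : {ffun 'I_n -> 'F_2}) (B : {set 'I_n}) :
  (#|differences (flip x B) y| + 2 * #|B :&: differences x y|
    = #|B| + #|differences x y|)%N.
Proof.
rewrite -!sum1_card !(big_mkcond (fun i => i \in _)) /= big_distrr -!big_split /=.
apply: eq_bigr => i _; rewrite !inE ffunE F2_add_neq.
by case: (i \in B); case: (x i != y i).
Qed.

Lemma natr_F2_eq0 m : (m%:R == 0 :> 'F_2) = ~~ odd m.
Proof. by rewrite -dvdn2 (dvdn_pcharf (pchar_Fp _)). Qed.

Section HalvedCube.

Variable n : nat.
Implicit Types (u v w : halved_cube n) (B : {set 'I_n}).

Definition word u : {ffun 'I_n -> 'F_2} := val u.

Lemma word_inj : injective word. Proof. exact: val_inj. Qed.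

Lemma sum_word u : \sum_i word u i = 0.
Proof. exact/eqP/(valP u). Qed.

Lemma flip_proof u B : ~~ odd #|B| -> \sum_i flip (word u) B i == 0.
Proof.
rewrite -natr_F2_eq0 => /eqP B0; under eq_bigr => i _ do rewrite ffunE.
rewrite big_split /= (sum_word u) add0r -[X in _ == X]B0 -sum1_card.
rewrite natr_sum [X in _ == X]big_mkcond; apply/eqP; apply: eq_bigr => i _.
by case: (i \in B).
Qed.

Definition even_flip u B (evenB : ~~ odd #|B|) : halved_cube n :=
  Sub (flip (word u) B) (flip_proof u evenB).

Lemma even_flipK u B evenB : word (@even_flip u B evenB) = flip (word u) B.
Proof. by []. Qed.

Definition zero_word : halved_cube n.
Proof. by exists [ffun=> 0]; rewrite big1 // => i _; rewrite ffunE. Defined.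

Lemma even_differences u v : ~~ odd #|differences (word u) (word v)|.
Proof.
rewrite -natr_F2_eq0 -sum1_card natr_sum big_mkcond /=.
rewrite (eq_bigr (fun i => word u i - word v i)).
  by rewrite sumrB (sum_word u) (sum_word v) subr0.
move=> i _; rewrite inE.
by move: (word u i) (word v i) => [[|[|a]] ?] [[|[|d]] ?] //=; apply: val_inj.
Qed.

Lemma dist_halved_cube u v : dist u v = #|differences (word u) (word v)|./2.
Proof.
apply: (dist_metric
  (m := fun u v : halved_cube n => #|differences (word u) (word v)|./2)).
- by move=> {}u; rewrite differences_refl cards0.
- move=> {}u w {}v /eqP uw.
  have duw : #|differences (word u) (word w)| = 2%N := uw.
  have := card_differences_triangle (word u) (word w) (word v).
  by rewrite duw => /half_leq.
move=> {}u {}v uv.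
have diff_gt0 : (0 < #|differences (word u) (word v)|)%N.
  rewrite lt0n cards_eq0; apply: contra uv => /eqP d0; apply/eqP/word_inj/ffunP => i.
  by apply/eqP; have /setP/(_ i) := d0; rewrite !inE => /negbFE.
have /card_gt1P[i [j [iD jD ij]]] : (1 < #|differences (word u) (word v)|)%N.
  by move: diff_gt0 (even_differences u v); case: #|_| => [|[|]].
have evenB : ~~ odd #|[set i; j]| by rewrite cards2 ij.
have := card_differences_flip (word u) (word u) [set i; j].
have := card_differences_flip (word u) (word v) [set i; j].
rewrite differences_refl setI0 cards0 (setIidPl _); last first.
  by apply/subsetP => k; rewrite !inE => /orP[] /eqP ->; rewrite ?inE in iD jD.
rewrite cards2 ij /= => cv cu; exists (even_flip u evenB).
  rewrite muln0 !addn0 -(even_flipK u evenB) differencesC in cu.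
  exact/eqP.
rewrite even_flipK -divn2 -[X in (_ < X)%N]divn2; lia.
Qed.

(** Write x for v_0 flipped along B and A for the differences of v_0 and v_(i+1).
    Rounding the uniform point 2b/n gives |B :&: A| <= 2b|A|/n + i, and
    4b <= n + 3 makes the first term at most (|A| + 3) / 2.  Hence x differs from
    v_(i+1) in at least 2b - 2i - 3 places; as this number is even, the distance
    is at least b - i - 1. *)
Lemma burn_halved_cube_gt b : (4 * b <= n + 3)%N -> (2 * b <= n)%N -> (0 < n)%N ->
  (b < burn (halved_cube n))%N.
Proof.
move=> le_4b le_2b n_gt0.
apply: (lt_burn zero_word) => v.
have n0 : 0 < n%:R :> rat by rewrite ltr0n.
pose A i := differences (word (v 0)) (word (v i.+1)).
have [e|z|B [cellB leB]] := @rounding rat _ _ (fun _ => tt)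
  (fun _ => (2 * b)%:R / n%:R) (fun _ => (2 * b)%N) A.
- by rewrite divr_ge0 ?ler0n //= ler_pdivrMr // mul1r ler_nat.
- rewrite (eq_bigl predT) => [|e]; last by case: z.
  by rewrite sumr_const card_ord -[_ *+ n]mulr_natr divfK ?gt_eqF.
have cB : #|B| = (2 * b)%N.
  by rewrite -[RHS](cellB tt); apply/eq_card => e; rewrite inE andbT.
have evenB : ~~ odd #|B| by rewrite cB mul2n odd_double.
exists (even_flip (v 0) evenB) => -[|i];
  rewrite dist_halved_cube differencesC even_flipK -divn2.
  have := card_differences_flip (word (v 0)) (word (v 0)) B.
  rewrite differences_refl setI0 cards0 cB muln0 !addn0 => ->; lia.
have := card_differences_flip (word (v 0)) (word (v i.+1)) B.
have := leB i; rewrite sumr_const -[_ *+ #|A i|]mulr_natl mulrA -natrM.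
move/(le_divn_of_rat n_gt0); rewrite -/(A i) => leBi.
have le_A : (#|A i| <= n)%N by rewrite -[X in (_ <= X)%N]card_ord max_card.
have : (#|A i| * (2 * b) %/ n <= (#|A i| + 3) %/ 2)%N.
  rewrite leq_divRL //; have := leq_trunc_div (#|A i| * (2 * b)) n; nia.
move: leBi; have := even_differences (even_flip (v 0) evenB) (v i.+1).
rewrite even_flipK -/(A i) cB.
set s := #|differences _ _|; set t := #|B :&: A i|; lia.
Qed.

(** The centres are the zero word and the word that is 1 everywhere, except at the
    last position when n is odd. *)
Lemma burn_halved_cube_le : (2 * burn (halved_cube n) <= (n + odd n)./2 + 3)%N.
Proof.
pose B := interval_set n 0 (n - odd n).
have cB : #|B| = (n - odd n)%N by rewrite card_interval_set // add0n leq_subr.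
have evenB : ~~ odd #|B| by rewrite cB; lia.
apply: (burn_le_average
  (v := fun i => if i is 0%N then zero_word else even_flip zero_word evenB)).
move=> x; rewrite !big_ord_recl big_ord0 /= !dist_halved_cube even_flipK.
set D := differences (word zero_word) (word x).
have cutD : (#|B :&: D| + #|D :\: B| = #|D|)%N by rewrite setIC cardsID.
have outD : (#|D :\: B| <= n - #|B|)%N.
  apply: (@leq_trans #|~: B|); first exact/subset_leq_card/subsetDr.
  by rewrite cardsCs setCK card_ord.
have := card_differences_flip (word zero_word) (word x) B; rewrite -/D.
set s := #|differences _ _|; move: cutD outD; rewrite cB -!divn2 /bump /=.
by set d := #|D|; set t := #|B :&: D|; lia.
Qed.

End HalvedCube.

(** * Burning numbers *)

Theorem theorem3 :
  (forall n q : nat, (1 <= n)%N -> (2 <= q)%N ->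
     Num.floor ((1 - q%:R^-1) * n%:R : rat) + 1 <= (burn (hamming n q))%:Z
     /\ (burn (hamming n q))%:Z <=
          Num.floor ((1 - q%:R^-1) * n%:R + (q%:R + 1) / 2 : rat))
  /\
  (forall n k : nat, (1 <= k)%N -> (k <= n - 1)%N -> (2 * k <= n)%N ->
     Num.ceil ((1 - k%:R / n%:R) * k%:R : rat) + 1 <= (burn (johnson n k))%:Z
     /\ (burn (johnson n k))%:Z <=
          Num.floor ((1 - ((Num.ceil (n%:R / k%:R : rat))%:~R)^-1) * k%:R
                     + ((Num.ceil (n%:R / k%:R : rat))%:~R + 1) / 2 : rat))
  /\
  (forall n : nat, (2 <= n)%N ->
     (burn (halved_cube n))%:Z = Num.ceil (n%:R / 4 : rat) + 1).
Proof.
split=> [n q n_gt0 q_gt1|]; last split=> [n k k_gt0 lt_kn _|n n_gt1].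
- have q_gt0 : (0 < q)%N by exact: ltnW.
  split; last exact: burn_hamming_le.
  suff : Num.floor ((1 - q%:R^-1) * n%:R : rat) <= (n - n %/ q)%N%:Z.
    by have := burn_hamming_gt n q_gt0; lia.
  rewrite -(ler_int rat); apply: le_trans (floor_le _) _.
  rewrite -pmulrn natrB ?leq_div // mulrBl mul1r lerD2l lerN2 mulrC.
  exact: floor_div_le.
- have le_kn : (k <= n)%N by lia.
  have n_gt0 : (0 < n)%N by exact: leq_trans k_gt0 le_kn.
  split.
    suff : Num.ceil ((1 - k%:R / n%:R) * k%:R : rat) <= (k - k * k %/ n)%N%:Z.
      by have := burn_johnson_gt le_kn n_gt0; lia.
    rewrite ceil_le_int -pmulrn natrB; last first.
      rewrite -[X in (_ <= X)%N](mulnK k n_gt0).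
      by rewrite leq_div2r // leq_mul2l le_kn orbT.
    rewrite mulrBl mul1r lerD2l lerN2 mulrAC -natrM.
    exact: floor_div_le.
  have : 0 <= Num.ceil (n%:R / k%:R : rat).
    by rewrite ceil_ge0 (lt_le_trans _ (divr_ge0 _ _)) ?ler0n.
  have := ceil_ge (n%:R / k%:R : rat); case: (Num.ceil _) => // p.
  rewrite -pmulrn ler_pdivrMr ?ltr0n // -natrM ler_nat => le_n _.
  exact: burn_johnson_le.
have -> : Num.ceil (n%:R / 4 : rat) = ((n + 3) %/ 4)%N%:Z.
  apply: ceil_def; rewrite ltr_pdivlMr // ler_pdivrMr //.
  rewrite [n%:R]pmulrn -[4 : rat]/(4%:~R) -!intrM ltr_int ler_int; lia.
have := @burn_halved_cube_gt n ((n + 3) %/ 4); have := burn_halved_cube_le n.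
by rewrite -divn2; lia.
Qed.
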